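(* (i) For every integer $n\ge 2$, $mon_2(K_n\Box K_n)=n$. (ii) Let $k$ be a positive integer and $t$ a positive even integer, and let $n=k\frac{t}{2}$. Then $mon_t(K_n\Box K_n)=k\frac{t^2}{4}$. (iii) With $k,t,n$ as in (ii), $mon_{2n-t}(K_n\Box K_n)=k(k-1)\frac{t^2}{4}$.
   Context: $K_n$ is the complete graph on $n$ vertices. The Cartesian product $G\Box H$ has vertex set $V(G)\times V(H)$, with $(u,v)$ adjacent to $(u',v')$ iff either $u=u'$ and $vv'\in E(H)$, or $v=v'$ and $uu'\in E(G)$. For a graph $G$ and constant threshold $t$ (at most every vertex degree), a set $M\subseteq V(G)$ is a $t$-monopoly if every vertex outside $M$ has at least $t$ neighbors in $M$; $mon_t(G)$ is the minimum size of a $t$-monopoly. *)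

(* Defs.v *)
From mathcomp Require Import all_boot.

Set Implicit Arguments.
Unset Strict Implicit.
Unset Printing Implicit Defensive.

Record sgraph := SGraph {
  vertex :> finType;
  adj : rel vertex;
  adj_sym : symmetric adj;
  adj_irrefl : irreflexive adj
}.

Section CompleteGraph.
Variable n : nat.

Definition complete_rel : rel 'I_n := fun u v => u != v.

Lemma complete_sym : symmetric complete_rel.
Proof. by move=> u v; rewrite /complete_rel eq_sym. Qed.

Lemma complete_irrefl : irreflexive complete_rel.
Proof. by move=> u; rewrite /complete_rel eqxx. Qed.

Definition complete_graph : sgraph := SGraph complete_sym complete_irrefl.
End CompleteGraph.

Section CartesianProduct.
Variables G H : sgraph.

Definition cart_rel : rel (G * H)%type := fun x y =>
  (x.1 == y.1) && adj x.2 y.2 || (x.2 == y.2) && adj x.1 y.1.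

Lemma cart_sym : symmetric cart_rel.
Proof.
move=> x y.
by rewrite /cart_rel (eq_sym x.1) (eq_sym x.2) (adj_sym x.1) (adj_sym x.2).
Qed.

Lemma cart_irrefl : irreflexive cart_rel.
Proof. by move=> x; rewrite /cart_rel !adj_irrefl !andbF. Qed.

Definition cart_prod : sgraph := SGraph cart_sym cart_irrefl.
End CartesianProduct.

Section Monopoly.
Variables (G : sgraph) (t : nat).

Definition neighbors (v : G) : {set G} := [set u | adj v u].

Definition monopoly (M : {set G}) : bool :=
  [forall v, (v \notin M) ==> (t <= #|neighbors v :&: M|)].

Lemma monopolyT : monopoly [set: G].
Proof. by apply/forallP => v; rewrite in_setT. Qed.

(* The minimum ranges over a nonempty family, by [monopolyT], even if [t]
   exceeds some vertex degrees. *)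
Definition mon : nat := #|[arg min_(M < [set: G] | monopoly M) #|M|]|.

Lemma monP :
  (exists2 M, monopoly M & #|M| = mon) /\ (forall M, monopoly M -> mon <= #|M|).
Proof.
rewrite /mon; case: arg_minnP => [|M monM minM]; first exact: monopolyT.
by split; first by exists M.
Qed.
End Monopoly.

Arguments mon : clear implicits.

(* Main.v *)
Require Import Defs.
From mathcomp Require Import all_boot.
From mathcomp Require Import zmodp ssralg zify.

Set Implicit Arguments.
Unset Strict Implicit.
Unset Printing Implicit Defensive.

(** A set of vertices of [K_n [] K_n] is a 0/1 matrix [m], and a vertex [(i, j)]
    outside it has (row sum of [i]) + (column sum of [j]) neighbours in it.
    Put [s = t / 2].  The circulant matrix with [s] ones in each row and column
    gives the upper bound in (ii), its complement the one in (iii).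

    Lower bound in (ii): if some line sum is below [s], let [a] be the least
    one, attained by, say, row [i].  The [n - a] columns in which row [i] has a
    zero have sums at least [2s - a], the others at least [a], so there are at
    least [(n - a)(2s - a) + a^2 = ns + (n - 2a)(s - a)] ones, and [2a <= n]
    when [k >= 2].  For [k = 1] the threshold exceeds all degrees.

    Lower bound in (iii): let [N] be the complement, with row sums [r] and
    column sums [c].  Summing [r_i + c_j <= 2s] over [N] gives
    [\sum r_i^2 + \sum c_j^2 <= 2s|N|], and [r^2 >= 2sr - s^2] turns this into
    [|N| <= ns].  Part (i) is (ii) with [t = 2]. *)

(** * Line sums and weight of square 0/1 matrices *)

Section BooleanMatrix.
Variable n : nat.
Implicit Type m : 'I_n -> 'I_n -> bool.

Definition row_sum m (i : 'I_n) : nat := \sum_j m i j.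
Definition col_sum m (j : 'I_n) : nat := \sum_i m i j.
Definition weight m : nat := \sum_i row_sum m i.

Lemma weight_col m : weight m = \sum_j col_sum m j.
Proof. exact: exchange_big. Qed.

Lemma sum_negb (b : 'I_n -> bool) : \sum_i b i + \sum_i (~~ b i) = n.
Proof.
rewrite -big_split /= (eq_bigr (fun=> 1)); first by rewrite sum1_card card_ord.
by move=> i _; case: (b i).
Qed.

Lemma sum_bool_ltn (b : 'I_n -> bool) i : ~~ b i -> \sum_j b j < n.
Proof.
by move=> bi; have := sum_negb b; rewrite [X in _ + X](bigD1 i) //= bi; lia.
Qed.

Lemma weight_negb m : weight m + weight (fun i j => ~~ m i j) = n * n.
Proof.
rewrite /weight -big_split /= (eq_bigr (fun=> n)).
  by rewrite sum_nat_const card_ord.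
by move=> i _; rewrite sum_negb.
Qed.

Lemma weight_regular m s : (forall i, row_sum m i = s) -> weight m = n * s.
Proof.
by move=> ms; rewrite /weight (eq_bigr (fun=> s)) // sum_nat_const card_ord.
Qed.

Lemma weight_geq m s : (forall i, s <= row_sum m i) -> n * s <= weight m.
Proof.
move=> ms; rewrite -[n in n * s]card_ord -sum_nat_const; exact: leq_sum.
Qed.

Lemma weight_geq_minimal_row m s i :
    2 * s <= n -> row_sum m i <= s ->
    (forall j, row_sum m i <= col_sum m j) ->
    (forall j, ~~ m i j -> 2 * s <= row_sum m i + col_sum m j) ->
  n * s <= weight m.
Proof.
set a := row_sum m i => s_n a_s a_min sum_ge.
(* The correction [2 * s - 2 * a] lifts the bound [a] at the ones of row [i] to the bound
   [2 * s - a] valid at its zeros. Row [i] has [a] ones, so summing gives [n * (2 * s - a) <= weight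
   m + a * (2 * s - 2 * a)]. *)
have: \sum_(j < n) (2 * s - a)
    <= \sum_j (col_sum m j + m i j * (2 * s - 2 * a)).
  apply: leq_sum => j _; have := a_min j; have := sum_ge j.
  by case: (m i j) => /= [_|/(_ isT)]; lia.
rewrite sum_nat_const card_ord big_split /= -weight_col -big_distrl /=.
rewrite -/(row_sum m i) -/a; nia.
Qed.

End BooleanMatrix.

(** * Weight bounds from sums of crossing lines *)

Lemma weight_geq_monopoly n (m : 'I_n -> 'I_n -> bool) s :
    2 * s <= n ->
    (forall i j, ~~ m i j -> 2 * s <= row_sum m i + col_sum m j) ->
  n * s <= weight m.
Proof.
move=> s_n sum_ge; case: (posnP n) => [n0|n_gt0].
  by rewrite [X in X * _]n0.
pose o := Ordinal n_gt0.
have [i _ i_min] := arg_minnP (row_sum m) (isT : predT o).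
have [j _ j_min] := arg_minnP (col_sum m) (isT : predT o).
case: (leqP s (row_sum m i)) => [s_i|i_s].
  by apply: weight_geq => x; apply: leq_trans s_i (i_min x isT).
case: (leqP (row_sum m i) (col_sum m j)) => [i_j|j_i].
  apply: (weight_geq_minimal_row (i := i)) => //.
  - exact: ltnW.
  - by move=> y; apply: leq_trans i_j (j_min y isT).
  - by move=> y; apply: sum_ge.
(* The least line is now a column: transposing keeps the weight and swaps rows with columns. *)
rewrite weight_col -/(weight (fun y x => m x y)).
apply: (weight_geq_minimal_row (i := j)) => //.
- by apply: ltnW; apply: ltn_trans i_s.
- by move=> x; apply: leq_trans (ltnW j_i) (i_min x isT).
- by move=> x /sum_ge; rewrite addnC.
Qed.

Lemma weight_leq_sum_bound n (m : 'I_n -> 'I_n -> bool) s :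
    0 < s ->
    (forall i j, m i j -> row_sum m i + col_sum m j <= 2 * s) ->
  weight m <= n * s.
Proof.
move=> s_gt0 sum_le.
have sq_row : \sum_i \sum_j m i j * row_sum m i = \sum_i row_sum m i ^ 2.
  by apply: eq_bigr => i _; rewrite -big_distrl.
have sq_col : \sum_i \sum_j m i j * col_sum m j = \sum_j col_sum m j ^ 2.
  by rewrite exchange_big; apply: eq_bigr => j _; rewrite -big_distrl.
have le_sq : \sum_i row_sum m i ^ 2 + \sum_j col_sum m j ^ 2
    <= weight m * (2 * s).
  rewrite -sq_row -sq_col -big_split /weight big_distrl /=.
  apply: leq_sum => i _; rewrite -big_split big_distrl /=.
  apply: leq_sum => j _; rewrite -mulnDr.
  by case: (boolP (m i j)) => // /sum_le; rewrite !mul1n.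
have sq_ge (f : 'I_n -> nat) :
    2 * s * (\sum_i f i) <= \sum_i f i ^ 2 + n * s ^ 2.
  have -> : n * s ^ 2 = \sum_(i < n) s ^ 2 by rewrite sum_nat_const card_ord.
  rewrite -big_split big_distrr /=.
  apply: leq_sum => i _; rewrite -mulnA (mulnC s).
  exact: nat_Cauchy.
have := sq_ge (row_sum m); have := sq_ge (col_sum m).
rewrite -weight_col -/(weight m) => ge_c ge_r.
(* With [w] the weight, adding the row and column bounds and using [le_sq] gives
   [4sw <= 2sw + 2ns^2]. *)
have : 2 * s * weight m <= 2 * s * (n * s) by nia.
by rewrite leq_pmul2l // muln_gt0.
Qed.

(** * Regular matrices from circulants *)

Definition circulant n s (i j : 'I_n.+1) : bool := (i - j : 'I_n.+1)%R < s.

Lemma sum_ltn_ord n s : s <= n -> \sum_(x < n) (x < s) = s.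
Proof.
move=> s_n; rewrite -(big_mkord predT (fun x => (x < s) : nat)).
rewrite (big_cat_nat (leq0n s) s_n) /= [X in _ + X]big1_seq ?addn0.
  rewrite (eq_big_nat _ _ (F2 := fun=> 1)) ?sum_nat_const_nat; first by lia.
  by move=> x /andP[_ ->].
by move=> x /=; rewrite mem_index_iota [x < s]ltnNge => /andP[-> _].
Qed.

(** Subtraction is modulo [n.+1], so [j] to [i - j] is a bijection and each row rearranges the
    indicator of [x < s]. *)
Lemma row_sum_circulant n s i : s <= n.+1 -> row_sum (@circulant n s) i = s.
Proof.
move=> s_n; rewrite -[RHS](@sum_ltn_ord n.+1 s) //.
rewrite [RHS](reindex_inj (h := fun j : 'I_n.+1 => (i - j)%R)) //.
by move=> j j' /GRing.addrI /GRing.oppr_inj.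
Qed.

Lemma col_sum_circulant n s j : s <= n.+1 -> col_sum (@circulant n s) j = s.
Proof.
move=> s_n; rewrite -[RHS](@sum_ltn_ord n.+1 s) //.
rewrite [RHS](reindex_inj (h := fun i : 'I_n.+1 => (i - j)%R)) //.
exact: GRing.addIr.
Qed.

Lemma regular_matrix_exists n s : s <= n ->
  exists m : 'I_n -> 'I_n -> bool,
    (forall i, row_sum m i = s) /\ (forall j, col_sum m j = s).
Proof.
case: n => [|n] s_n; first by exists (fun _ _ => true); split; case.
by exists (@circulant n s); split=> i;
  [apply: row_sum_circulant | apply: col_sum_circulant].
Qed.

(** * Monopolies of the rook graph as matrices *)

Section RookGraph.
Variable n : nat.

Definition rook : sgraph := cart_prod (complete_graph n) (complete_graph n).

Definition incidence (M : {set rook}) (i j : 'I_n) : bool :=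
  ((i, j) : rook) \in M.

Definition set_of_matrix (m : 'I_n -> 'I_n -> bool) : {set rook} :=
  [set v : rook | m v.1 v.2].

Lemma card_weight (M : {set rook}) : #|M| = weight (incidence M).
Proof.
rewrite -sum1_card big_mkcond /weight /row_sum pair_bigA /=.
by apply: eq_bigr => -[i j] _; rewrite /incidence; case: (_ \in _).
Qed.

(** Row [i] and column [j] meet only in [(i, j)], which is not in [M], so nothing is counted
    twice. *)
Lemma card_neighbors (M : {set rook}) i j : ~~ incidence M i j ->
  #|neighbors (G := rook) (i, j) :&: M|
    = row_sum (incidence M) i + col_sum (incidence M) j.
Proof.
move=> Mij; rewrite card_weight.
have -> : row_sum (incidence M) i = \sum_a \sum_b (a == i) * incidence M a b.
  rewrite (bigD1 i) //= [X in _ + X]big1 ?addn0.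
    by apply: eq_bigr => b _; rewrite eqxx mul1n.
  by move=> a /negbTE ->; rewrite big1.
have -> : col_sum (incidence M) j = \sum_a \sum_b (b == j) * incidence M a b.
  apply: eq_bigr => a _; rewrite (bigD1 j) //= eqxx mul1n.
  by rewrite big1 ?addn0 // => b /negbTE ->.
rewrite -big_split; apply: eq_bigr => a _; rewrite -big_split.
apply: eq_bigr => b _ /=.
rewrite {1}/incidence !inE /= /cart_rel /= /complete_rel -/(incidence M a b).
rewrite (eq_sym i) (eq_sym j).
case: (altP (a =P i)) => [->|_]; case: (altP (b =P j)) => [->|_] //=.
- by rewrite (negbTE Mij).
- by case: (incidence M i b).
- by case: (incidence M a j).
Qed.

Lemma monopoly_rookP t (M : {set rook}) :
  reflect (forall i j, ~~ incidence M i j ->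
             t <= row_sum (incidence M) i + col_sum (incidence M) j)
          (monopoly t M).
Proof.
apply: (iffP forallP) => [tM i j Mij | tM [i j]].
  by rewrite -card_neighbors //; apply: (implyP (tM (i, j))).
by apply/implyP => Mij; rewrite card_neighbors //; apply: tM.
Qed.

Lemma incidence_set_of_matrix m i j :
  incidence (set_of_matrix m) i j = m i j.
Proof. by rewrite /incidence inE. Qed.

Lemma mon_rook_leq t (m : 'I_n -> 'I_n -> bool) :
    (forall i j, ~~ m i j -> t <= row_sum m i + col_sum m j) ->
  mon rook t <= weight m.
Proof.
move=> tm; have inc := incidence_set_of_matrix m.
have row_inc i : row_sum (incidence (set_of_matrix m)) i = row_sum m i.
  by apply: eq_bigr => j _; rewrite inc.
have col_inc j : col_sum (incidence (set_of_matrix m)) j = col_sum m j.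
  by apply: eq_bigr => i _; rewrite inc.
have -> : weight m = #|set_of_matrix m|.
  by rewrite card_weight; apply: eq_bigr => i _; rewrite row_inc.
apply: (monP rook t).2; apply/monopoly_rookP => i j.
by rewrite inc row_inc col_inc; apply: tm.
Qed.

Lemma mon_rook_attained t :
  exists m : 'I_n -> 'I_n -> bool,
    (forall i j, ~~ m i j -> t <= row_sum m i + col_sum m j)
    /\ weight m = mon rook t.
Proof.
have [[M /monopoly_rookP tM M_min] _] := monP rook t.
by exists (incidence M); rewrite -card_weight.
Qed.

Lemma mon_rook_double s : 2 * s <= n \/ s = n -> mon rook (2 * s) = n * s.
Proof.
move=> sn; have s_n : s <= n by lia.
apply/eqP; rewrite eqn_leq; apply/andP; split.
  have [m [ms m's]] := regular_matrix_exists s_n.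
  rewrite -(weight_regular ms); apply: mon_rook_leq => i j _.
  by rewrite ms m's; lia.
have [m [tm <-]] := mon_rook_attained (2 * s).
case: sn => [s2_n|s_eq]; first exact: weight_geq_monopoly.
(* A zero entry would leave both of its line sums below [n], so their total could not reach
   [2 * n]. *)
subst s; have m1 i j : m i j.
  apply/negPn/negP => mij; have := tm i j mij.
  have := sum_bool_ltn mij; have := sum_bool_ltn (mij : ~~ (m ^~ j) i).
  by rewrite -/(row_sum m i) -/(col_sum m j); lia.
apply: weight_geq => i; rewrite /row_sum (eq_bigr (fun=> 1)) => [|j _].
  by rewrite sum1_card card_ord.
by rewrite m1.
Qed.

Lemma mon_rook_codouble s : 0 < s -> s <= n ->
  mon rook (2 * n - 2 * s) = n * (n - s).
Proof.
move=> s_gt0 s_n; apply/eqP; rewrite eqn_leq; apply/andP; split.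
  have [m [ms m's]] := regular_matrix_exists (leq_subr s n).
  rewrite -(weight_regular ms); apply: mon_rook_leq => i j _.
  by rewrite ms m's; lia.
have [m [tm <-]] := mon_rook_attained (2 * n - 2 * s).
have := weight_leq_sum_bound (m := fun i j => ~~ m i j) s_gt0.
have := weight_negb m.
set w := weight (fun i j => ~~ m i j) => w_m w_le.
suff : w <= n * s by rewrite mulnBr; lia.
(* Complementing turns each line sum [x] into [n - x], so the threshold [2 * n - 2 * s] becomes the
   upper bound [2 * s]. *)
apply: w_le => i j /tm.
have := sum_negb (m i); have := sum_negb (m ^~ j).
by rewrite /row_sum /col_sum; lia.
Qed.

End RookGraph.

Theorem theorem3 :
  [/\ forall n : nat, 2 <= n ->
        mon (cart_prod (complete_graph n) (complete_graph n)) 2 = n,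
      forall k t n : nat, 0 < k -> 0 < t -> ~~ odd t -> n = k * (t %/ 2) ->
        mon (cart_prod (complete_graph n) (complete_graph n)) t
          = k * (t ^ 2 %/ 4)
    & forall k t n : nat, 0 < k -> 0 < t -> ~~ odd t -> n = k * (t %/ 2) ->
        mon (cart_prod (complete_graph n) (complete_graph n)) (2 * n - t)
          = k * (k - 1) * (t ^ 2 %/ 4)].
Proof.
have half t : 0 < t -> ~~ odd t ->
    exists s, [/\ 0 < s, t = 2 * s, t %/ 2 = s & t ^ 2 %/ 4 = s * s].
  move=> t_gt0 t_even; exists t./2.
  have t_eq : t = 2 * t./2 by lia.
  split; [lia | by [] | lia |].
  by rewrite [in LHS]t_eq expnMn mulKn.
split=> [n n_ge2 | k t n k_gt0 t_gt0 t_even | k t n k_gt0 t_gt0 t_even].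
- by rewrite -[RHS]muln1; apply: (@mon_rook_double n 1); left.
- have [s [s_gt0 -> -> ->] n_eq] := half t t_gt0 t_even.
  rewrite mulnA -n_eq; apply: mon_rook_double; rewrite n_eq.
  (* Since [n = k * s], either [k >= 2] and [2 * s <= n], or [k = 1] and [s = n]. *)
  case: (leqP 2 k) => k_2; [left | right]; last by have -> : k = 1; lia.
  by rewrite leq_mul2r k_2 orbT.
- have [s [s_gt0 -> -> ->] n_eq] := half t t_gt0 t_even.
  rewrite [LHS](@mon_rook_codouble n s) //; last by nia.
  by rewrite n_eq -[X in _ * (_ - X)]mul1n -mulnBl mulnACA.
Qed.
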